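(* Let $K$ be a Noetherian commutative ring with unit. For every $n\in\mathbb N$ the $n$-stable variety $\mathfrak S^n$ of representations of groups over $K$ is an action type Noetherian variety.
   Context: A representation $(V,G)$ over $K$ is a group $G$ together with a right $KG$-module $V$ (action written $v\circ g$). A homomorphism of representations $(\alpha,\beta):(V,G)\to(W,H)$ is a $K$-module homomorphism $\alpha:V\to W$ together with a group homomorphism $\beta:G\to H$ such that $(v\circ g)^\alpha=v^\alpha\circ g^\beta$. $\mathfrak S^n$ is the class of all representations $(V,G)$ over $K$ satisfying the identity $x\circ(y_1-1)(y_2-1)\cdots(y_n-1)=0$, i.e. $v\circ(g_1-1)\cdots(g_n-1)=0$ for all $v\in V$, $g_1,\dots,g_n\in G$. For finite sets $X,Y$ let $F(Y)$ be the free group on $Y$, $XKF(Y)=\bigoplus_{x\in X}xKF(Y)$ the free right $KF(Y)$-module with basis $X$, and $W(X,Y)=(XKF(Y),F(Y))$. For a variety $\Theta$ of representations over $K$, let $Id_{a.t.}(\Theta,X,Y)$ be the set of $w\in XKF(Y)$ such that $w^\alpha=0$ for every homomorphism $(\alpha,\beta)$ from $W(X,Y)$ to a member of $\Theta$, and $Id_{gr}(\Theta,Y)$ the set of $f\in F(Y)$ such that $f^\beta=1$ for every such $(\alpha,\beta)$. Put $E_\Theta(X,Y)=XKF(Y)/Id_{a.t.}(\Theta,X,Y)$ and $F_\Theta(Y)=F(Y)/Id_{gr}(\Theta,Y)$; then $(E_\Theta(X,Y),F_\Theta(Y))$ is the free representation of $\Theta$ on $X,Y$. $\Theta$ is called action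 type Noetherian if for all finite $X,Y$ every $KF_\Theta(Y)$-submodule of $E_\Theta(X,Y)$ is finitely generated as a $KF_\Theta(Y)$-module. *)

(* Defs.v *)
From HB Require Import structures.
From mathcomp Require Import all_boot all_algebra.
From mathcomp Require Import finmap monalg.
From mathcomp Require Import boolp.

Set Implicit Arguments.
Unset Strict Implicit.
Unset Printing Implicit Defensive.

Import GRing.Theory.
Local Open Scope ring_scope.
Local Open Scope quotient_scope.

Definition submodule (R : pzRingType) (V : lmodType R) (N : V -> Prop) : Prop :=
  [/\ N 0, (forall v w, N v -> N w -> N (v + w)) &
      (forall (a : R) v, N v -> N (a *: v))].

Definition finitely_generated (R : pzRingType) (V : lmodType R)
    (N : V -> Prop) : Prop :=
  exists (m : nat) (e : 'I_m -> V),
    (forall i, N (e i)) /\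
    (forall v, N v -> exists c : 'I_m -> R, v = \sum_(i < m) c i *: e i).

Definition noetherian_module (R : pzRingType) (V : lmodType R) : Prop :=
  forall N : V -> Prop, submodule N -> finitely_generated N.

(* The submodules of the regular module [K^o] are the ideals of K. *)
Definition noetherian_ring (K : comPzRingType) : Prop :=
  noetherian_module (K^o : lmodType K).

(* Finitely supported functions G -> K.  The ring structure that monalg puts on
   [{malg K[G]}] requires a monoid without nontrivial units, hence the alias. *)
Definition group_ring (K : pzRingType) (G : groupType) : Type := {malg K[G]}.

Section GroupRing.
Variables (K : pzRingType) (G : groupType).

HB.instance Definition _ := GRing.Zmodule.on (group_ring K G).

(* Extension of a family of additive maps F g : K -> A to an additive map
   KG -> A. *)
Definition gext (A : zmodType) (F : G -> K -> A) (u : group_ring K G) : A :=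
  \sum_(g <- msupp u) F g u@_g.

Definition gmul (u v : group_ring K G) : group_ring K G :=
  gext (fun g a => gext (fun h b => << a * b *g (g * h)%g >>) v) u.

Definition gone : group_ring K G := << 1 *g 1%g >>.

Section Extension.
Variables (A : zmodType) (F : G -> K -> A).
Hypothesis FD : forall g, {morph F g : a b / a + b}.

Let F0 g : F g 0 = 0.
Proof. by apply: (addrI (F g 0)); rewrite -FD !addr0. Qed.

Lemma gext_wide (d : {fset G}) (u : group_ring K G) :
  (msupp u `<=` d)%fset -> gext F u = \sum_(g <- d) F g u@_g.
Proof.
move=> ud; rewrite /gext; apply: big_fset_incl => // g _ gNu.
by rewrite mcoeff_outdom.
Qed.

Lemma gextD : {morph gext F : u v / u + v}.
Proof.
move=> u v; set d := (msupp u `|` msupp v)%fset.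
rewrite (@gext_wide d (u + v)) ?msuppD_le //.
rewrite (@gext_wide d u) ?fsubsetUl // (@gext_wide d v) ?fsubsetUr //.
by rewrite -big_split /=; apply: eq_bigr => g _; rewrite mcoeffD FD.
Qed.

Lemma gext0 : gext F 0 = 0.
Proof. by apply: (addrI (gext F 0)); rewrite -gextD !addr0. Qed.

Lemma gextU c g : gext F << c *g g >> = F g c.
Proof.
rewrite (@gext_wide [fset g]%fset) ?msuppU_le //.
by rewrite big_seq_fset1 mcoeffUU.
Qed.
End Extension.

Lemma group_ring_ind (P : group_ring K G -> Prop) :
  P 0 -> (forall u v, P u -> P v -> P (u + v)) ->
  (forall c g, P << c *g g >>) -> forall u, P u.
Proof. by move=> P0 PD PU u; rewrite [u]monalgE; apply: big_ind. Qed.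

Let inner_D v g :
  {morph (fun a => gext (fun h b => << a * b *g (g * h)%g >> : group_ring K G) v)
    : a b / a + b}.
Proof.
move=> a b; rewrite /gext -big_split /=; apply: eq_bigr => h _.
by rewrite mulrDl monalgUD.
Qed.

Let innermost_D a g :
  forall h, {morph (fun b => << a * b *g (g * h)%g >> : group_ring K G)
    : b c / b + c}.
Proof. by move=> h b c; rewrite mulrDr monalgUD. Qed.

Fact gmulDl : left_distributive gmul +%R.
Proof. by move=> u v w; apply: (gextD (inner_D w)). Qed.

Fact gmulDr : right_distributive gmul +%R.
Proof.
move=> u v w; rewrite /gmul /gext -big_split /=; apply: eq_bigr => g _.
exact: (gextD (innermost_D _ g)).
Qed.

Fact gmulUU a b g h :
  gmul << a *g g >> << b *g h >> = << a * b *g (g * h)%g >>.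
Proof.
by rewrite /gmul (gextU (inner_D _)) (gextU (innermost_D _ _)).
Qed.

Let gmul0 u : gmul u 0 = 0.
Proof. by apply: (addrI (gmul u 0)); rewrite -gmulDr !addr0. Qed.

Let gmul0g u : gmul 0 u = 0.
Proof. by apply: (addrI (gmul 0 u)); rewrite -gmulDl !addr0. Qed.

Fact gmulA : associative gmul.
Proof.
move=> u v w; elim/group_ring_ind: u => [|u u' Hu Hu'|a g].
- by rewrite !gmul0g.
- by rewrite !gmulDl Hu Hu'.
elim/group_ring_ind: v => [|v v' Hv Hv'|b h].
- by rewrite !(gmul0g, gmul0).
- by rewrite !(gmulDl, gmulDr) Hv Hv'.
elim/group_ring_ind: w => [|w w' Hw Hw'|c k].
- by rewrite !gmul0.
- by rewrite !gmulDr Hw Hw'.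
by rewrite !gmulUU mulrA mulgA.
Qed.

Fact gmul1g : left_id gone gmul.
Proof.
move=> u; elim/group_ring_ind: u => [|u v Hu Hv|c g]; first exact: gmul0.
  by rewrite gmulDr Hu Hv.
by rewrite gmulUU !mul1r mul1g.
Qed.

Fact gmulg1 : right_id gone gmul.
Proof.
move=> u; elim/group_ring_ind: u => [|u v Hu Hv|c g]; first exact: gmul0g.
  by rewrite gmulDl Hu Hv.
by rewrite gmulUU !mulr1 mulg1.
Qed.

HB.instance Definition _ := GRing.Zmodule_isPzRing.Build (group_ring K G)
  gmulA gmul1g gmulg1 gmulDl gmulDr.
End GroupRing.

Definition gelt (K : pzRingType) (G : groupType) (g : G) : group_ring K G :=
  << 1 *g g >>.
Definition gcst (K : pzRingType) (G : groupType) (c : K) : group_ring K G :=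
  << c *g 1%g >>.
Arguments gelt {K G} g.
Arguments gcst {K G} c.

(* Right KG-modules are left modules over the converse ring of KG; [v ∘ u] is the
   right action of u : KG on v, so that g : G acts by [v ∘ gelt g]. *)
Notation rmodType K G := (lmodType (group_ring K G)^c).

Definition ract (K : pzRingType) (G : groupType) (V : rmodType K G)
  (v : V) (u : group_ring K G) : V := (u : (group_ring K G)^c) *: v.
Notation "v ∘ u" := (ract v u) (at level 40, left associativity) : ring_scope.

Section Ract.
Variables (K : pzRingType) (G : groupType) (V : rmodType K G).

Lemma ractD (v : V) : {morph ract v : u u' / u + u'}.
Proof. by move=> u u'; exact: (scalerDl v). Qed.

Lemma ractM (v : V) u u' : v ∘ (u * u') = v ∘ u ∘ u'.
Proof. by rewrite /ract scalerA. Qed.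

Lemma ract0 (v : V) : v ∘ 0 = 0.
Proof. exact: scale0r. Qed.

Lemma ract0l u : (0 : V) ∘ u = 0.
Proof. exact: scaler0. Qed.

Lemma ractDl (v w : V) u : (v + w) ∘ u = v ∘ u + w ∘ u.
Proof. exact: scalerDr. Qed.

Lemma ractBl (v w : V) u : (v - w) ∘ u = v ∘ u - w ∘ u.
Proof. exact: scalerBr. Qed.

Lemma ract1 (v : V) : v ∘ gelt 1%g = v.
Proof. exact: scale1r. Qed.

Lemma ractU (v : V) c g : v ∘ << c *g g >> = v ∘ gcst c ∘ gelt g.
Proof. by rewrite -ractM [_ * _]gmulUU mulr1 mul1g. Qed.
End Ract.

Record representation (K : comPzRingType) := Representation {
  rep_grp : groupType;
  rep_mod : rmodType K rep_grp
}.

(* The K-module structure of V is c.v = v ∘ gcst c. *)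
Record rep_hom (K : comPzRingType) (V W : representation K) := RepHom {
  hom_mod : {additive rep_mod V -> rep_mod W};
  hom_grp : {multiplicative rep_grp V -> rep_grp W};
  hom_modZ : forall (c : K) v, hom_mod (v ∘ gcst c) = hom_mod v ∘ gcst c;
  hom_modJ : forall v g, hom_mod (v ∘ gelt g) = hom_mod v ∘ gelt (hom_grp g)
}.

Definition stable (K : comPzRingType) (n : nat) (V : representation K) : Prop :=
  forall (v : rep_mod V) (g : 'I_n -> rep_grp V),
    v ∘ (\prod_(i < n) (gelt (g i) - 1)) = 0.

Definition normal_subgroup (G : groupType) (N : G -> Prop) : Prop :=
  [/\ N 1%g, (forall g h, N g -> N h -> N (g * h)%g),
      (forall g, N g -> N g^-1%g) & (forall g h, N g -> N (g ^ h)%g)].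

Section QuotientGroup.
Variables (G : groupType) (N : G -> Prop) (nN : normal_subgroup N).

Definition qgrp_rel (g h : G) : bool := `[< N (g * h^-1)%g >].

Fact qgrp_equiv : equiv_class_of qgrp_rel.
Proof.
have [N1 NM NV _] := nN; split=> [g|g h|h g k].
- by apply/asboolP; rewrite mulgV.
- by apply/asboolP/asboolP => /NV; rewrite invgM invgK.
by move=> /asboolP gh /asboolP hk; apply/asboolP; have := NM _ _ gh hk;
   rewrite mulgA mulgVK.
Qed.

Canonical qgrp_equivrel := EquivRelPack qgrp_equiv.
Canonical qgrp_encmodrel := defaultEncModRel qgrp_rel.

Definition quotient_group := {eq_quot qgrp_rel}.

HB.instance Definition _ := EqQuotient.on quotient_group.
HB.instance Definition _ := Choice.on quotient_group.

Definition qpi (g : G) : quotient_group := \pi_quotient_group g.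

Lemma qpi_eq g h : qpi g = qpi h <-> N (g * h^-1)%g.
Proof.
rewrite /qpi; split=> [/eqP|gh]; first by rewrite piE => /asboolP.
by apply/eqP; rewrite piE; apply/asboolP.
Qed.

Definition qgrp_mul (a b : quotient_group) := qpi (repr a * repr b)%g.
Definition qgrp_inv (a : quotient_group) := qpi (repr a)^-1%g.

Lemma qpi_repr a : qpi (repr a) = a.
Proof. exact: reprK. Qed.

Lemma qgrp_mulE g h : qgrp_mul (qpi g) (qpi h) = qpi (g * h)%g.
Proof.
have [_ NM _ NJ] := nN; apply/qpi_eq.
have /qpi_eq Ng := qpi_repr (qpi g); have /qpi_eq Nh := qpi_repr (qpi h).
have := NM _ _ Ng (NJ _ g^-1%g Nh).
by rewrite /conjg invgK invgM !mulgA mulgVK.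
Qed.

Lemma qgrp_invE g : qgrp_inv (qpi g) = qpi g^-1%g.
Proof.
have [_ _ NV NJ] := nN; apply/qpi_eq; rewrite invgK.
have /qpi_eq/NV Ng := qpi_repr (qpi g).
have := NJ _ g Ng.
by rewrite /conjg invgM invgK mulgA mulKg.
Qed.

Fact qgrp_mulA : associative qgrp_mul.
Proof.
move=> a b c; rewrite -[a]qpi_repr -[b]qpi_repr -[c]qpi_repr.
by rewrite !qgrp_mulE mulgA.
Qed.

Fact qgrp_mul1g : left_id (qpi 1%g) qgrp_mul.
Proof. by move=> a; rewrite -[a]qpi_repr qgrp_mulE mul1g. Qed.

Fact qgrp_mulg1 : right_id (qpi 1%g) qgrp_mul.
Proof. by move=> a; rewrite -[a]qpi_repr qgrp_mulE mulg1. Qed.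

Fact qgrp_mulVg : left_inverse (qpi 1%g) qgrp_inv qgrp_mul.
Proof. by move=> a; rewrite -[a]qpi_repr qgrp_invE qgrp_mulE mulVg. Qed.

Fact qgrp_mulgV : right_inverse (qpi 1%g) qgrp_inv qgrp_mul.
Proof. by move=> a; rewrite -[a]qpi_repr qgrp_invE qgrp_mulE mulgV. Qed.

HB.instance Definition _ := isGroup.Build quotient_group
  qgrp_mulA qgrp_mul1g qgrp_mulg1 qgrp_mulVg qgrp_mulgV.
End QuotientGroup.

(* For a right KG-module V, a normal subgroup N of G and a KG-submodule P of V
   containing all v ∘ g - v with g in N, the quotient V/P is a right
   K(G/N)-module. *)
Section QuotientModule.
Variables (K : pzRingType) (G : groupType) (V : rmodType K G).
Variables (N : G -> Prop) (P : V -> Prop).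
Hypotheses (nN : normal_subgroup N) (subP : submodule P).
Hypothesis PN : forall (v : V) g, N g -> P (v ∘ gelt g - v).

Definition qmod_pred : pred V := fun v => `[< P v >].

Fact qmod_zmod_closed : zmod_closed qmod_pred.
Proof.
have [P0 PD PZ] := subP; split=> [|v w]; first exact/asboolP.
move=> /asboolP Pv /asboolP Pw; apply/asboolP; apply: PD => //.
by rewrite -scaleN1r; exact: PZ.
Qed.

HB.instance Definition _ := GRing.isZmodClosed.Build V qmod_pred qmod_zmod_closed.

Definition quotient_module : Type :=
  Quotient.quot (GRing.ZmodClosed.clone V qmod_pred _).

HB.instance Definition _ := EqQuotient.on quotient_module.
HB.instance Definition _ := GRing.Zmodule.on quotient_module.

Definition mpi (v : V) : quotient_module := \pi_quotient_module v.

Lemma mpi_eq v w : mpi v = mpi w <-> P (v - w).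
Proof.
rewrite /mpi; split=> [/eqP|Pvw].
  by rewrite -Quotient.idealrBE => /asboolP.
by apply/eqP; rewrite -Quotient.idealrBE; apply/asboolP.
Qed.

Lemma mpiD : {morph mpi : v w / v + w}.
Proof. by move=> v w; rewrite /mpi -(raddfD (\pi_quotient_module)). Qed.

Lemma mpi_repr a : mpi (repr a) = a.
Proof. exact: reprK. Qed.

(* The K-linear section of KG -> K(G/N) given by representatives. *)
Definition glift : group_ring K (quotient_group nN) -> group_ring K G :=
  gext (fun (q : quotient_group nN) c => << c *g repr q >>).

Definition qmod_scale (u : (group_ring K (quotient_group nN))^c)
  (a : quotient_module) : quotient_module := mpi (repr a ∘ glift u).

Lemma gliftD : {morph glift : u u' / u + u'}.
Proof. by apply: gextD => q a b; rewrite monalgUD. Qed.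

Lemma gliftU c q : glift << c *g q >> = << c *g repr q >>.
Proof. by apply: gextU => r a b; rewrite monalgUD. Qed.

Lemma glift0 : glift 0 = 0.
Proof. by apply: gext0 => q a b; rewrite monalgUD. Qed.

Lemma mpi_ract v w u : mpi v = mpi w -> mpi (v ∘ u) = mpi (w ∘ u).
Proof.
have [_ _ PZ] := subP.
by move=> /mpi_eq Pvw; apply/mpi_eq; rewrite -ractBl; exact: PZ.
Qed.

Lemma mpi_coset v c g h : qpi nN g = qpi nN h ->
  mpi (v ∘ << c *g g >>) = mpi (v ∘ << c *g h >>).
Proof.
move=> /qpi_eq Ngh; have [_ _ PZ] := subP; apply/mpi_eq.
have -> : << c *g g >> = gelt (g * h^-1)%g * (<< c *g h >> : group_ring K G).
  by rewrite [RHS]gmulUU mul1r mulgVK.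
by rewrite ractM -ractBl; apply: PZ; exact: PN.
Qed.

Lemma qmod_scaleE u v : qmod_scale u (mpi v) = mpi (v ∘ glift u).
Proof. by apply: mpi_ract; exact: mpi_repr. Qed.

Lemma mpi_gliftM v u u' : mpi (v ∘ glift (u * u')) = mpi (v ∘ glift u ∘ glift u').
Proof.
elim/group_ring_ind: u => [|u1 u2 IH1 IH2|c q].
- by rewrite mul0r glift0 ract0 ract0l.
- rewrite mulrDl (gliftD (u1 * u')) ractD mpiD.
  by rewrite (gliftD u1) (ractD v) ractDl mpiD; congr (_ + _).
elim/group_ring_ind: u' => [|u1 u2 IH1 IH2|d r].
- by rewrite mulr0 glift0 !ract0.
- rewrite mulrDr (gliftD (_ * u1)) ractD mpiD.
  by rewrite (gliftD u1) (ractD (v ∘ _)) mpiD; congr (_ + _).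
rewrite [_ * _ in LHS]gmulUU !gliftU -ractM [_ * _ in RHS]gmulUU.
apply: mpi_coset; rewrite qpi_repr -[in LHS](qpi_repr q) -[in LHS](qpi_repr r).
exact: qgrp_mulE.
Qed.

Fact qmod_scaleA a b x : qmod_scale a (qmod_scale b x) = qmod_scale (a * b) x.
Proof. by rewrite -[x]mpi_repr !qmod_scaleE mpi_gliftM. Qed.

Fact qmod_scale1 : left_id 1 qmod_scale.
Proof.
move=> x; rewrite -[x]mpi_repr qmod_scaleE gliftU.
rewrite (@mpi_coset _ _ _ 1%g) ?qpi_repr //.
by rewrite /ract scale1r.
Qed.

Fact qmod_scaleDr : right_distributive qmod_scale +%R.
Proof.
move=> a x y; rewrite -[x]mpi_repr -[y]mpi_repr -mpiD !qmod_scaleE -mpiD.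
by rewrite /ract scalerDr.
Qed.

Fact qmod_scaleDl x : {morph qmod_scale^~ x : a b / a + b}.
Proof. by move=> a b; rewrite -[x]mpi_repr !qmod_scaleE gliftD ractD mpiD. Qed.

Definition quotient_rmod : rmodType K (quotient_group nN) :=
  HB.pack quotient_module (GRing.Zmodule_isLmodule.Build
    (group_ring K (quotient_group nN))^c quotient_module
    qmod_scaleA qmod_scale1 qmod_scaleDr qmod_scaleDl).
End QuotientModule.

(* Reduced words in the letters y = (y, true) and y^-1 = (y, false). *)
Section FreeGroup.
Variable Y : choiceType.
Implicit Types (l : Y * bool) (s t : seq (Y * bool)).

Definition linv l : Y * bool := (l.1, ~~ l.2).

Definition reduced s : bool := sorted (fun l l' => l' != linv l) s.

Record free_group := FreeGroup { word : seq (Y * bool); _ : reduced word }.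

HB.instance Definition _ := [isSub for word].
HB.instance Definition _ := [Choice of free_group by <:].

(* Left multiplication of a reduced word by a letter. *)
Definition lcons l s : seq (Y * bool) :=
  if s is l' :: s' then if l' == linv l then s' else l :: s else [:: l].

Definition wmul s t : seq (Y * bool) := foldr lcons t s.

Definition winv s : seq (Y * bool) := rev (map linv s).

Lemma linvK : involutive linv.
Proof. by case=> y b; rewrite /linv /= negbK. Qed.

Lemma lcons_reduced l s : reduced s -> reduced (lcons l s).
Proof.
case: s => //= l' s; have [_|ne] := eqVneq l' (linv l) => red; last first.
  by rewrite /= ne.
exact: path_sorted red.
Qed.

Lemma wmul_reduced s t : reduced t -> reduced (wmul s t).
Proof. by move=> red; elim: s => //= l s; exact: lcons_reduced. Qed.

Lemma lconsK l s : reduced s -> lcons (linv l) (lcons l s) = s.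
Proof.
case: s => [|l' s] /= red; first by rewrite linvK eqxx.
have [e|ne] := eqVneq l' (linv l); last by rewrite /= linvK eqxx.
by case: s red => [|l'' s] /=; rewrite e // => /andP[/negPf->].
Qed.

Lemma wmul_lcons l s t : reduced t -> wmul (lcons l s) t = lcons l (wmul s t).
Proof.
move=> red; case: s => //= l' s; case: eqVneq => //= ->.
by rewrite -{1}[l]linvK lconsK // wmul_reduced.
Qed.

Lemma wmulA s t u : reduced u -> wmul s (wmul t u) = wmul (wmul s t) u.
Proof. by move=> red; elim: s => //= l s ->; rewrite wmul_lcons. Qed.

Lemma wmul1 s : reduced s -> wmul s [::] = s.
Proof.
elim: s => //= l s IHs red; rewrite IHs; last exact: path_sorted red.
by case: s red {IHs} => //= l' s /andP[/negPf->].
Qed.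

Lemma winv_reduced s : reduced s -> reduced (winv s).
Proof.
rewrite /reduced /winv rev_sorted sorted_map; apply: sub_sorted => l l' /=.
by apply: contraNneq => /(can_inj linvK) ->; rewrite linvK.
Qed.

Lemma winvK : involutive winv.
Proof.
move=> s; rewrite /winv map_rev revK -map_comp map_id_in // => l _.
exact: linvK.
Qed.

Lemma wmulV s : wmul (winv s) s = [::].
Proof.
elim: s => // l s IHs; rewrite /winv map_cons rev_cons /wmul foldr_rcons /=.
by rewrite linvK eqxx.
Qed.

Definition fg_one : free_group := @FreeGroup [::] isT.
Definition fg_mul (a b : free_group) : free_group :=
  FreeGroup (wmul_reduced (word a) (valP b)).
Definition fg_inv (a : free_group) : free_group :=
  FreeGroup (winv_reduced (valP a)).

Fact fg_mulA : associative fg_mul.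
Proof. by move=> a b c; apply: val_inj; apply: wmulA; exact: valP. Qed.

Fact fg_mul1g : left_id fg_one fg_mul.
Proof. by move=> a; apply: val_inj. Qed.

Fact fg_mulg1 : right_id fg_one fg_mul.
Proof. by move=> a; apply: val_inj; apply: wmul1; exact: valP. Qed.

Fact fg_mulVg : left_inverse fg_one fg_inv fg_mul.
Proof. by move=> a; apply: val_inj; exact: wmulV. Qed.

Fact fg_mulgV : right_inverse fg_one fg_inv fg_mul.
Proof.
by move=> a; apply: val_inj; rewrite /= -{1}[word a]winvK; exact: wmulV.
Qed.

HB.instance Definition _ := isGroup.Build free_group
  fg_mulA fg_mul1g fg_mulg1 fg_mulVg fg_mulgV.

Definition fg_gen (y : Y) : free_group := @FreeGroup [:: (y, true)] isT.
End FreeGroup.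

(* The free right KF(Y)-module with basis X: X-indexed families of elements of
   the regular right module KF(Y). *)
Definition free_rmod (K : pzRingType) (X : finType) (Y : choiceType) :
    rmodType K (free_group Y) :=
  {ffun X -> ((group_ring K (free_group Y))^c)^o}.

(* The representation W(X,Y) = (XKF(Y), F(Y)). *)
Definition free_rep (K : comPzRingType) (X Y : finType) : representation K :=
  Representation (free_rmod K X Y).

Section Identities.
Variables (K : comPzRingType) (T : representation K -> Prop).

(* Id_at T X Y and Id_gr T Y are the sets Id_{a.t.}(T,X,Y) and Id_{gr}(T,Y).  The
   latter does not depend on the X of the homomorphisms from W(X,Y), since a
   group homomorphism F(Y) -> G always extends by the zero map on XKF(Y). *)
Definition Id_at (X Y : finType) (w : free_rmod K X Y) : Prop :=
  forall (V : representation K) (h : rep_hom (free_rep K X Y) V),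
    T V -> hom_mod h w = 0.

Definition Id_gr (Y : finType) (f : free_group Y) : Prop :=
  forall (X : finType) (V : representation K) (h : rep_hom (free_rep K X Y) V),
    T V -> hom_grp h f = 1%g.

Fact Id_gr_normal (Y : finType) : normal_subgroup (@Id_gr Y).
Proof.
have h1 (X : finType) V (h : rep_hom (free_rep K X Y) V) : hom_grp h 1%g = 1%g.
  by apply: (mulgI (hom_grp h 1%g)); rewrite -gmulfM !mulg1.
split=> [|f g If Ig|f If|f g If] X V h TV.
- exact: h1.
- by rewrite gmulfM (If _ _ _ TV) (Ig _ _ _ TV) mulg1.
- by apply: (mulgI (hom_grp h f)); rewrite -gmulfM mulgV h1 (If _ _ _ TV) mulg1.
- by rewrite /conjg !gmulfM (If _ _ _ TV) mul1g -gmulfM mulVg h1.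
Qed.

Fact Id_at_submodule (X Y : finType) : submodule (@Id_at X Y).
Proof.
split=> [|v w Iv Iw|u v Iv] V h TV; first exact: raddf0.
  by rewrite raddfD (Iv _ _ TV) (Iw _ _ TV) addr0.
rewrite -[u *: v]/(v ∘ u); elim/group_ring_ind: u => [|u u' Hu Hu'|c g].
- by rewrite ract0 raddf0.
- by rewrite ractD raddfD /= Hu Hu' addr0.
by rewrite ractU hom_modJ hom_modZ (Iv _ _ TV) !ract0l.
Qed.

Fact Id_at_gr (X Y : finType) (w : free_rmod K X Y) (f : free_group Y) :
  Id_gr f -> Id_at (w ∘ gelt f - w).
Proof.
by move=> If V h TV; rewrite raddfB /= hom_modJ (If _ _ _ TV) ract1 subrr.
Qed.
End Identities.

(* A variety is a class of representations axiomatized by a set A of identities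
   w = 0 of action type and a set B of group identities f = 1; each identity
   involves finitely many variables. *)
Definition is_variety (K : comPzRingType) (T : representation K -> Prop) : Prop :=
  exists (A : forall m k, free_rmod K 'I_m 'I_k -> Prop)
         (B : forall k, free_group 'I_k -> Prop),
  forall V : representation K, T V <->
    (forall m k (w : free_rmod K 'I_m 'I_k), A m k w ->
       forall h : rep_hom (free_rep K 'I_m 'I_k) V, hom_mod h w = 0) /\
    (forall k (f : free_group 'I_k), B k f ->
       forall m (h : rep_hom (free_rep K 'I_m 'I_k) V), hom_grp h f = 1%g).

(* F_T(Y) = F(Y) / Id_gr(T,Y). *)
Definition rel_free_group (K : comPzRingType) (T : representation K -> Prop)
  (Y : finType) : groupType := quotient_group (Id_gr_normal T Y).

(* E_T(X,Y) = XKF(Y) / Id_at(T,X,Y), as a right KF_T(Y)-module. *)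
Definition rel_free_rmod (K : comPzRingType) (T : representation K -> Prop)
    (X Y : finType) : rmodType K (rel_free_group T Y) :=
  quotient_rmod (Id_gr_normal T Y) (Id_at_submodule T X Y)
    (@Id_at_gr K T X Y).

Definition action_type_noetherian (K : comPzRingType)
    (T : representation K -> Prop) : Prop :=
  forall X Y : finType, noetherian_module (rel_free_rmod T X Y).

(* Main.v *)
(** The Fox-calculus argument: writing a letter as z = 1 + (z - 1) and expanding,
    KF(Y) is spanned over K by the products (z_1 - 1)...(z_r - 1) of letters z_i
    in Y or Y^-1.  In E(X,Y) those with r >= n act as zero, so E(X,Y) is a finitely
    generated K-module; as K is Noetherian, all its K-submodules are finitely
    generated, over K and a fortiori over KF(Y).  *)

Require Import Defs.
From HB Require Import structures.
From mathcomp Require Import all_boot all_algebra.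
From mathcomp Require Import finmap monalg boolp.

Set Implicit Arguments.
Unset Strict Implicit.
Unset Printing Implicit Defensive.

Import GRing.Theory.
Local Open Scope ring_scope.

(** * Submodules of finite free modules over a Noetherian ring *)

Lemma finitely_generated_fin (R : pzRingType) (V : lmodType R) (N : V -> Prop)
    (I : finType) (e : I -> V) :
  (forall i, N (e i)) ->
  (forall v, N v -> exists c : I -> R, v = \sum_i c i *: e i) ->
  finitely_generated N.
Proof.
move=> Ne gen; exists #|I|, (e \o enum_val); split=> [i|v /gen[c ->]] /=.
  exact: Ne.
exists (c \o enum_val); rewrite (reindex (@enum_val I predT)) //=.
exact/onW_bij/enum_val_bij.
Qed.

Lemma submodule_sum (R : pzRingType) (V : lmodType R) (N : V -> Prop)
    (I : finType) (c : I -> R) (e : I -> V) :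
  submodule N -> (forall i, N (e i)) -> N (\sum_i c i *: e i).
Proof. by case=> N0 ND NZ Ne; apply: big_ind => // i _; exact: NZ. Qed.

(** Induction on [m], splitting off the first coordinate: a submodule is generated by lifts of
    generators of its ideal of leading entries, together with generators of its part with leading
    entry 0. *)
Lemma noetherian_rV (K : comPzRingType) (m : nat) :
  noetherian_ring K -> noetherian_module 'rV[K]_m.
Proof.
move=> hK; elim: m => [|m IHm].
  move=> N subN; apply: (@finitely_generated_fin _ _ _ 'I_0 (fun=> 0)) => [[]//|v _].
  by exists (fun=> 0); rewrite big_ord0; apply/rowP=> -[].
rewrite -[m.+1]/(1 + m)%N => N subN; have [N0 ND NZ] := subN.
pose I (a : K^o) := exists2 v : 'rV[K]_(1 + m), N v & v 0 0 = a.
have subI : submodule I.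
  split=> [|a b [v Nv <-] [w Nw <-]|a b [v Nv <-]].
  - by exists 0; rewrite ?mxE.
  - by exists (v + w); rewrite ?mxE //; exact: ND.
  - by exists (a *: v); rewrite ?mxE //; exact: NZ.
have [p [a [Ia genI]]] := hK _ subI.
have [v Nv] := choice (fun i => (let: ex_intro2 v Nv e := Ia i in
  ex_intro (fun v => N v /\ v 0 0 = a i) v (conj Nv e))).
pose N' (w : 'rV[K]_m) := N (row_mx 0 w).
have subN' : submodule N'.
  split=> [|w w'|c w]; rewrite /N'.
  - by rewrite row_mx0.
  - by move=> Nw Nw'; rewrite -[0](addr0 0) -add_row_mx; exact: ND.
  - by move=> Nw; rewrite -[0](scaler0 _ c) -scale_row_mx; exact: NZ.
have [q [w [Nw genN']]] := IHm _ subN'.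
pose e (i : 'I_p + 'I_q) : 'rV[K]_(1 + m) :=
  match i with inl i => v i | inr j => row_mx 0 (w j) end.
apply: (@finitely_generated_fin _ _ _ _ e) => [[i|j]|u Nu] /=.
- by case: (Nv i).
- exact: Nw.
have [c uc] : exists c : 'I_p -> K, u 0 0 = \sum_i c i * a i.
  by apply: genI; exists u.
(* Subtracting the lifts [v i], weighted by the coefficients found for the leading entry of [u],
   clears that entry; the rest is covered by [N']. *)
pose u' := u - \sum_i c i *: v i.
have Nu' : N u'.
  apply: ND => //; rewrite -scaleN1r; apply: NZ; apply: submodule_sum => // i.
  by case: (Nv i).
have u'E : u' = row_mx 0 (rsubmx u').
  rewrite -[LHS]hsubmxK; congr row_mx; apply/rowP=> i; rewrite ord1 !mxE.
  rewrite (_ : lshift m 0 = 0); last exact/val_inj.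
  rewrite uc summxE -sumrB big1 // => j _.
  by rewrite mxE; case: (Nv j) => _ ->; rewrite subrr.
have [d ud] : exists d : 'I_q -> K, rsubmx u' = \sum_j d j *: w j.
  by apply: genN'; rewrite /N' -u'E.
exists (fun i => match i with inl i => c i | inr j => d j end).
rewrite big_sumType /= -[LHS](subrK (\sum_i c i *: v i)) addrC -/u'; congr +%R.
rewrite u'E ud; apply/rowP=> k; rewrite summxE !mxE.
case: split_ordP => i ->; last first.
  by rewrite summxE; apply: eq_bigr => j _; rewrite [LHS]mxE [RHS]mxE row_mxEr.
by rewrite mxE big1 // => j _; rewrite mxE row_mxEl mxE mulr0.
Qed.

(** * Constants and group elements in the group ring *)

Section GroupRingTheory.
Variables (K : comPzRingType) (G : groupType).

Lemma gcstD : {morph @gcst K G : a b / a + b}.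
Proof. by move=> a b; rewrite /gcst monalgUD. Qed.

Lemma gcst0 : @gcst K G 0 = 0.
Proof. by rewrite /gcst monalgU0. Qed.

Lemma gcstM : {morph @gcst K G : a b / a * b}.
Proof. by move=> a b; rewrite [RHS]gmulUU mulg1. Qed.

Lemma gcst_comm c (u : group_ring K G) : u * gcst c = gcst c * u.
Proof.
elim/group_ring_ind: u => [|u v Hu Hv|a g]; first by rewrite mul0r mulr0.
  by rewrite mulrDl mulrDr Hu Hv.
by rewrite [LHS]gmulUU [RHS]gmulUU mulg1 mul1g mulrC.
Qed.

Lemma geltM : {morph @gelt K G : g h / (g * h)%g >-> g * h}.
Proof. by move=> g h; rewrite [RHS]gmulUU mulr1. Qed.
End GroupRingTheory.

Lemma ract_suml (K : pzRingType) (G : groupType) (V : rmodType K G)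
    (I : finType) (v : I -> V) (u : group_ring K G) :
  (\sum_i v i) ∘ u = \sum_i v i ∘ u.
Proof. exact: scaler_sumr. Qed.

(** * Spanning over K inside a KG-module *)

Section KSpan.
Variables (K : comPzRingType) (G : groupType) (V : rmodType K G).
Variables (I : finType) (e : I -> V).

Definition k_span (v : V) : Prop := exists c : I -> K, v = \sum_i e i ∘ gcst (c i).

Lemma k_span0 : k_span 0.
Proof. by exists (fun=> 0); rewrite big1 // => i _; rewrite gcst0 ract0. Qed.

Lemma k_spanD v w : k_span v -> k_span w -> k_span (v + w).
Proof.
move=> [c ->] [d ->]; exists (fun i => c i + d i).
by rewrite -big_split; apply: eq_bigr => i _; rewrite gcstD ractD.
Qed.

Lemma k_spanZ v a : k_span v -> k_span (v ∘ gcst a).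
Proof.
move=> [c ->]; exists (fun i => c i * a); rewrite ract_suml.
by apply: eq_bigr => i _; rewrite [in RHS]gcstM [RHS]ractM.
Qed.

Lemma k_span_gen i : k_span (e i).
Proof.
exists (fun j => (j == i)%:R); rewrite (bigD1 i) //= big1 => [|j /negPf->].
  by rewrite eqxx addr0 [_ ∘ _]ract1.
by rewrite gcst0 ract0.
Qed.

(** A KG-submodule is pulled back along the K-linear surjection [L] from a row space. The preimage
    is finitely generated over K, and the images of its generators generate [N] with constants as
    coefficients, hence over KG. *)
Lemma noetherian_k_span :
  noetherian_ring K -> (forall v, k_span v) -> noetherian_module V.
Proof.
move=> hK gen N subN; have [N0 ND NZ] := subN.
pose L (c : 'rV[K]_#|I|) : V := \sum_i e i ∘ gcst (c 0 (enum_rank i)).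
have L0 : L 0 = 0 by rewrite /L big1 // => i _; rewrite mxE gcst0 ract0.
have LD c d : L (c + d) = L c + L d.
  by rewrite /L -big_split; apply: eq_bigr => i _; rewrite mxE gcstD ractD.
have LZ a c : L (a *: c) = L c ∘ gcst a.
  rewrite /L /ract scaler_sumr; apply: eq_bigr => i _.
  (* Centrality of constants moves [a] behind the coordinate, the order that the right action
     requires. *)
  by rewrite mxE -/(ract _ _) gcstM -gcst_comm ractM.
have subNL : submodule (fun c => N (L c)).
  split=> [|c d Nc Nd|a c Nc]; rewrite ?L0 ?LD ?LZ //; first exact: ND.
  exact: NZ.
have [m [c [Nc genc]]] := noetherian_rV hK subNL.
apply: (@finitely_generated_fin _ _ _ _ (L \o c)) => // v.
have [d vd] := gen v; pose r : 'rV[K]_#|I| := \row_i d (enum_val i).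
have -> : v = L r.
  by rewrite vd; apply: eq_bigr => i _; rewrite mxE enum_rankK.
move=> /genc[b ->]; exists (fun i => gcst (b i)).
by rewrite (big_morph _ LD L0); apply: eq_bigr => i _; rewrite LZ.
Qed.

End KSpan.

(** * Universal property of the free group *)

Section FreeGroupLift.
Variables (Y : choiceType) (G : groupType) (g : Y -> G).

Definition letter_val (l : Y * bool) : G := if l.2 then g l.1 else (g l.1)^-1%g.

Definition fg_lift (a : free_group Y) : G :=
  foldr (fun l x => (letter_val l * x)%g) 1%g (word a).

Lemma letter_val_linv l : (letter_val l * letter_val (linv l))%g = 1%g.
Proof. by case: l => y [] /=; rewrite /letter_val /= ?mulgV ?mulVg. Qed.

(** [wmul] departs from concatenation only by cancelling a letter against its inverse, and such a
    pair evaluates to 1. *)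
Fact fg_liftM : {morph fg_lift : a b / (a * b)%g}.
Proof.
move=> a b; rewrite /fg_lift /=.
elim: (word a) => [|l s IHs] /=; first by rewrite mul1g.
rewrite -mulgA -IHs; case: (wmul s (word b)) => [|l' t] //=.
by case: eqVneq => //= ->; rewrite mulgA letter_val_linv mul1g.
Qed.

HB.instance Definition _ :=
  monoid.isMultiplicative.Build (free_group Y) G fg_lift fg_liftM.

Lemma fg_lift_gen y : fg_lift (fg_gen y) = g y.
Proof. by rewrite /fg_lift /= mulg1. Qed.
End FreeGroupLift.

(** * Universal property of the representation W(X,Y) *)

Section FreeRepLift.
Variables (K : comPzRingType) (X Y : finType) (V : representation K).
Variables (v : X -> rep_mod V) (g : Y -> rep_grp V).

Definition gring_lift : group_ring K (free_group Y) -> group_ring K (rep_grp V) :=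
  gext (fun f c => << c *g fg_lift g f >>).

Lemma gring_liftD : {morph gring_lift : u u' / u + u'}.
Proof. by apply: gextD => f a b; rewrite monalgUD. Qed.

Lemma gring_liftU c f : gring_lift << c *g f >> = << c *g fg_lift g f >>.
Proof. by apply: gextU => h a b; rewrite monalgUD. Qed.

Lemma gring_lift0 : gring_lift 0 = 0.
Proof. by apply: gext0 => h a b; rewrite monalgUD. Qed.

(** Monomials include both the constants and the group elements, so this serves both compatibility
    conditions of [rep_hom]. *)
Lemma gring_liftMU (u : group_ring K (free_group Y)) c f :
  gring_lift (u * << c *g f >>) = gring_lift u * << c *g fg_lift g f >>.
Proof.
elim/group_ring_ind: u => [|u u' Hu Hu'|a h].
- by rewrite mul0r gring_lift0 mul0r.
- apply: etrans (congr1 gring_lift (mulrDl u u' _)) _.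
  apply: etrans (gring_liftD _ _) _.
  apply: etrans (esym (congr1 (fun z => z * _) (gring_liftD u u'))).
  apply: etrans (esym (mulrDl _ _ _)).
  by congr (_ + _); [exact: Hu | exact: Hu'].
by rewrite [_ * _ in LHS]gmulUU !gring_liftU [RHS]gmulUU fg_liftM.
Qed.

Definition mod_lift (w : free_rmod K X Y) : rep_mod V :=
  \sum_x v x ∘ gring_lift (w x).

Fact mod_lift_additive : zmod_morphism mod_lift.
Proof.
move=> w w'; rewrite /mod_lift -sumrB; apply: eq_bigr => x _.
apply/eqP; rewrite eq_sym subr_eq -ractD -gring_liftD; apply/eqP.
by rewrite !ffunE subrK.
Qed.

HB.instance Definition _ := GRing.isZmodMorphism.Build
  (free_rmod K X Y) (rep_mod V) mod_lift mod_lift_additive.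

Lemma mod_liftU w c f :
  mod_lift (w ∘ << c *g f >>) = mod_lift w ∘ << c *g fg_lift g f >>.
Proof.
rewrite [RHS]scaler_sumr; apply: eq_bigr => x _.
by rewrite -[RHS]ractM -gring_liftMU ffunE.
Qed.

Fact mod_liftZ (c : K) w : mod_lift (w ∘ gcst c) = mod_lift w ∘ gcst c.
Proof. exact: mod_liftU. Qed.

Fact mod_liftJ w f : mod_lift (w ∘ gelt f) = mod_lift w ∘ gelt (fg_lift g f).
Proof. exact: mod_liftU. Qed.

(** Existence half of freeness, used to evaluate identities at arbitrary [v] and [g]. *)
Definition rep_lift : rep_hom (free_rep K X Y) V :=
  @RepHom K (free_rep K X Y) V mod_lift (fg_lift g) mod_liftZ mod_liftJ.
End FreeRepLift.

Definition free_gen (K : comPzRingType) (X Y : finType) (x : X) : free_rmod K X Y :=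
  [ffun y => (y == x)%:R].

Lemma mod_lift_gen (K : comPzRingType) (X Y : finType) (V : representation K)
    (v : X -> rep_mod V) (g : Y -> rep_grp V) x :
  mod_lift v g (free_gen K Y x) = v x.
Proof.
rewrite /mod_lift (bigD1 x) //= big1 => [|y /negPf yx].
  by rewrite ffunE eqxx addr0 [gring_lift _ _]gring_liftU -[RHS]ract1.
by rewrite ffunE yx [gring_lift _ _]gring_lift0 ract0.
Qed.

Lemma free_genE (K : comPzRingType) (X Y : finType) (w : free_rmod K X Y) :
  w = \sum_x free_gen K Y x ∘ w x.
Proof.
apply/ffunP=> y; rewrite sum_ffunE (bigD1 y) //= big1 => [|x /negPf xy].
  by rewrite !ffunE eqxx addr0; exact/esym/mulr1.
by rewrite !ffunE eq_sym xy; exact: mulr0.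
Qed.

(** * Stability along words and the defining identities *)

Lemma hom_mod_prod (K : comPzRingType) (V W : representation K)
    (h : rep_hom V W) (v : rep_mod V) (s : seq (rep_grp V)) :
  hom_mod h (v ∘ \prod_(g <- s) (gelt g - 1)) =
  hom_mod h v ∘ \prod_(g <- s) (gelt (hom_grp h g) - 1).
Proof.
elim: s v => [|g s IHs] v; first by rewrite !big_nil /ract !scale1r.
rewrite !big_cons !ractM IHs; congr ract.
by rewrite /ract !scalerBl raddfB !scale1r; congr (_ - _); exact: hom_modJ.
Qed.

(** The first [n] factors already annihilate [v]; the later ones act on 0. *)
Lemma stable_prod (K : comPzRingType) (n : nat) (V : representation K)
    (v : rep_mod V) (s : seq (rep_grp V)) :
  stable n V -> (n <= size s)%N -> v ∘ \prod_(g <- s) (gelt g - 1) = 0.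
Proof.
move=> stV ns; rewrite -(cat_take_drop n s) big_cat ractM.
rewrite (big_nth 1%g) size_takel // big_mkord stV; exact: ract0l.
Qed.

Lemma stable_variety (K : comPzRingType) (n : nat) : is_variety (@stable K n).
Proof.
(* The action type identities are all stability relations inside free representations; the set of
   group identities is empty. *)
exists (fun m k w => exists v (f : 'I_n -> free_group 'I_k),
  w = v ∘ \prod_(i < n) (gelt (f i) - 1)), (fun _ _ => False) => V.
have prodE (G : groupType) (f : 'I_n -> G) :
    \prod_(i < n) (gelt (f i) - 1) =
    \prod_(g <- codom f) (gelt g - 1 : group_ring K G).
  by rewrite codomE big_map enumT [index_enum _]unlock.
split=> [stV|[stV _] v g].
  split=> // m k _ [v [f ->]] h; rewrite prodE hom_mod_prod.
  by rewrite -(big_map (hom_grp h) predT (fun g => gelt g - 1)) (stable_prod _ stV) //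
    size_map size_codom card_ord.
(* One module generator and [n] free group generators give the generic stability relation, which [h]
   specializes to [v] and [g]. *)
pose h := rep_lift (fun _ : 'I_1 => v) g.
have := stV 1 n _ (ex_intro _ (free_gen K _ ord0) (ex_intro _ _ erefl)) h.
move=> /(_ (@fg_gen _)); rewrite prodE hom_mod_prod /= mod_lift_gen => <-.
rewrite codomE big_map enumT [index_enum _]unlock; congr ract.
by apply: eq_bigr => i _; rewrite fg_lift_gen.
Qed.

(** * Fox expansion in the free n-stable representation *)

Section StableNoetherian.
Variables (K : comPzRingType) (n : nat) (X Y : finType).
Let T := @stable K n.
Let E := rel_free_rmod T X Y.

Definition letter (l : Y * bool) : free_group Y := @FreeGroup Y [:: l] isT.

(** Words may be unreduced here: dropping letters during the expansion can bring a letter next to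
    its inverse. *)
Definition fox (s : seq (Y * bool)) : group_ring K (free_group Y) :=
  \prod_(l <- s) (gelt (letter l) - 1).

Let pr (w : free_rmod K X Y) : E := Defs.mpi (Id_at_submodule T X Y) w.

Let prD w w' : pr (w + w') = pr w + pr w'.
Proof. exact: mpiD. Qed.

Let pr0 : pr 0 = 0.
Proof. by apply: (addrI (pr 0)); rewrite -prD !addr0. Qed.

Let pr_gcst w c : pr w ∘ gcst c = pr (w ∘ gcst c).
Proof.
(* The action on [E] goes through the chosen representative of the identity coset, which may differ
   from 1 but acts alike modulo [Id_at]. *)
rewrite [LHS]qmod_scaleE gliftU.
exact: (mpi_coset _ (@Id_at_gr K T X Y) w c (qpi_repr (1%g : rel_free_group T Y))).
Qed.

(** Finitely many K-generators, since bounded sequences over a finite type form a finite type; those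
    of length exactly [n] are zero in [E]. *)
Let e (i : X * (n.-bseq (Y * bool))) : E := pr (free_gen K Y i.1 ∘ fox i.2).

Let S := k_span e.

(** A homomorphism into an n-stable representation sends a product of more than [n] factors to one
    of the same length, which acts as zero; so it vanishes in [E]. *)
Let S_fox x s : S (pr (free_gen K Y x ∘ fox s)).
Proof.
have [sn|ns] := leqP (size s) n; first exact: (k_span_gen e (x, Bseq sn)).
rewrite (_ : pr _ = 0); first exact: k_span0.
rewrite -pr0; apply/(mpi_eq (Id_at_submodule T X Y)).
rewrite subr0 => V h stV; rewrite /fox -(big_map letter predT (fun g => gelt g - 1)).
rewrite hom_mod_prod -(big_map (hom_grp h) predT (fun g => gelt g - 1)).
by rewrite (stable_prod _ stV) // !size_map ltnW.
Qed.

(** Induction on the word of [f] for all [s] at once: writing the first letter as z = (z - 1) + 1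
    leaves the shorter word acting after [fox (rcons s l)] and after [fox s]. *)
Let S_gelt x s (f : free_group Y) : S (pr (free_gen K Y x ∘ fox s ∘ gelt f)).
Proof.
case: f => w; elim: w s => [|l w IHw] s red.
  rewrite (_ : FreeGroup red = 1%g); last exact: val_inj.
  by rewrite ract1; exact: S_fox.
have red' : reduced w := path_sorted red.
(* Reducedness of the word excludes cancellation when [l] is multiplied back. *)
have -> : FreeGroup red = (letter l * FreeGroup red')%g.
  apply: val_inj => /=; case: (w) red => //= l' w'.
  by case: (l' == linv l).
rewrite geltM -[gelt (letter l)](subrK 1) mulrDl mul1r ractD prD.
apply: k_spanD; last exact: IHw.
rewrite [_ ∘ (_ * gelt _)]ractM.
by have := IHw (rcons s l) red'; rewrite /fox -cats1 big_cat big_seq1 /=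
  [_ ∘ (_ * (_ - _))]ractM.
Qed.

Let S_ract x (u : group_ring K (free_group Y)) : S (pr (free_gen K Y x ∘ u)).
Proof.
elim/group_ring_ind: u => [|u u' Hu Hu'|c f].
- by rewrite ract0 pr0; exact: k_span0.
- have uD : free_gen K Y x ∘ (u + u') = free_gen K Y x ∘ u + free_gen K Y x ∘ u'.
    exact: ractD.
  by rewrite uD prD; apply: k_spanD; [exact: Hu | exact: Hu'].
(* The constant is central, so it can act last, where the K-span absorbs it. *)
rewrite ractU -ractM -gcst_comm ractM -pr_gcst; apply: k_spanZ.
by have := S_gelt x [::] f; rewrite /fox big_nil [_ ∘ 1]scale1r.
Qed.

Let S_all a : S a.
Proof.
rewrite -[a]mpi_repr -/(pr _) [repr a]free_genE (big_morph pr prD pr0).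
by apply: big_ind => [||x _]; [exact: k_span0 | exact: k_spanD | exact: S_ract].
Qed.

Lemma stable_free_noetherian : noetherian_ring K -> noetherian_module E.
Proof. by move=> hK; apply: (noetherian_k_span hK S_all). Qed.
End StableNoetherian.

Theorem proposition6p2 (K : comPzRingType) (hK : noetherian_ring K) (n : nat) :
  is_variety (@stable K n) /\ action_type_noetherian (@stable K n).
Proof.
split; first exact: stable_variety.
by move=> X Y; exact: stable_free_noetherian.
Qed.
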